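(* Let $\mathbb X^0_z(\mathbb C)$ be the group, under composition, of formal power series $\sum_{n=1}^\infty a_nz^n$ over $\mathbb C$ with $a_1\neq0$. Let $G$ be a subgroup of $\mathbb X^0_z(\mathbb C)$ containing no series $f$ such that $[z^1]f$ is a root of unity different from $1$, and containing at least one series $f$ with $[z^1]f\neq1$. Then $G$ is normal in $\mathbb X_z^0(\mathbb C)$ if and only if there exists a subgroup $G'$ of the multiplicative group $(\mathbb C\setminus\{0\},\cdot)$ such that $G=\{a_1z+a_2z^2+\cdots : a_1\in G',\ a_2,a_3,\ldots\in\mathbb C\}$.
   Context: $[z^1]f$ denotes the coefficient of $z$ in $f$. The composition of series with zero constant term is formal substitution: $g\circ f=\sum_{k\ge1}b_kf^k$ for $g=\sum_{k\ge1}b_kz^k$; the identity of $\mathbb X^0_z(\mathbb C)$ is the series $z$. *)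

(* Defs.v *)
From HB Require Import structures.
From mathcomp Require Import all_boot all_algebra.
From mathcomp Require Import boolp classical_sets reals.
From mathcomp Require Import complex.

Set Implicit Arguments.
Unset Strict Implicit.
Unset Printing Implicit Defensive.

Import GRing.Theory.

Local Open Scope ring_scope.

(* The coefficient of z^n in the series [f : nat -> F] is [f n]. *)
Section Series.
Variable F : fieldType.
Implicit Types (f g h : nat -> F) (p q : {poly F}).

Definition ser_mul f g : nat -> F :=
  fun n => \sum_(i < n.+1) f i * g (n - i)%N.

Definition ser_one : nat -> F := fun n => (n == 0)%:R.

Definition ser_pow f k : nat -> F := iter k (ser_mul f) ser_one.

(* g o f = \sum_(k >= 1) g_k f^k.  For f with zero constant term f^k has no
   term of degree < k, so the coefficient of z^n only involves k <= n. *)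
Definition ser_comp g f : nat -> F :=
  fun n => \sum_(1 <= k < n.+1) g k * ser_pow f k n.

Definition ser_id : nat -> F := fun n => (n == 1)%:R.

Lemma ser_pow0 f : ser_pow f 0 = ser_one. Proof. by []. Qed.

Lemma ser_powS f k : ser_pow f k.+1 = ser_mul f (ser_pow f k).
Proof. by []. Qed.

Lemma eq_ser_pow f g k n : (forall i, (i <= n)%N -> f i = g i) ->
  ser_pow f k n = ser_pow g k n.
Proof.
elim: k n => [//|k IHk] n efg; rewrite !ser_powS; apply: eq_bigr => i _.
congr (_ * _); first by apply: efg; case: i.
by apply: IHk => j le_j; apply: efg; apply: leq_trans le_j (leq_subr _ _).
Qed.

Lemma eq_ser_comp f f' g g' n :
  (forall i, (i <= n)%N -> f i = f' i) ->
  (forall i, (i <= n)%N -> g i = g' i) ->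
  ser_comp g f n = ser_comp g' f' n.
Proof.
move=> eqf eqg; apply: eq_big_nat => k /andP[_ le_k].
by rewrite eqg // (eq_ser_pow _ eqf).
Qed.

Lemma ser_pow_gt f k n : f 0%N = 0 -> (n < k)%N -> ser_pow f k n = 0.
Proof.
move=> f0; elim: k n => [//|k IHk] n lt_nk; rewrite ser_powS /ser_mul.
rewrite big_ord_recl f0 mul0r add0r big1 // => i _.
rewrite IHk ?mulr0 // /lift /= /bump /= add1n; case: n lt_nk i => [|n] lt_nk i.
  by case: i.
by rewrite subSS (leq_ltn_trans (leq_subr _ _)).
Qed.

Lemma ser_pow_diag f n : f 0%N = 0 -> ser_pow f n n = f 1%N ^+ n.
Proof.
move=> f0; elim: n => [//|n IHn]; rewrite ser_powS /ser_mul.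
rewrite big_ord_recl f0 mul0r add0r big_ord_recl /= /bump /= subSS subn0 IHn.
rewrite exprS big1 ?addr0 // => i _; rewrite ser_pow_gt ?mulr0 //.
by rewrite /= /bump /= !add1n subSS ltn_subrL; case: n {IHn} i => [[]|].
Qed.

Lemma coef_ser_pow p k n : (p ^+ k)`_n = ser_pow (nth 0 p) k n.
Proof.
elim: k n => [|k IHk] n; first by rewrite expr0 coef1.
by rewrite exprS coefM ser_powS; apply: eq_bigr => i _; rewrite IHk.
Qed.

Lemma coef_ser_comp p q n : p`_0 = 0 -> q`_0 = 0 ->
  (p \Po q)`_n = ser_comp (nth 0 p) (nth 0 q) n.
Proof.
move=> p0 q0; rewrite coef_comp_poly.
pose T k := p`_k * (q ^+ k)`_n.
have T_big k : (n < k)%N -> T k = 0.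
  by move=> lt_nk; rewrite /T coef_ser_pow ser_pow_gt ?mulr0.
have T_sz k : (size p <= k)%N -> T k = 0.
  by move=> le_k; rewrite /T nth_default ?mul0r.
have -> : ser_comp (nth 0 p) (nth 0 q) n = \sum_(0 <= k < n.+1) T k.
  rewrite [RHS]big_ltn // {1}/T p0 mul0r add0r.
  by apply: eq_bigr => k _; rewrite /T coef_ser_pow.
rewrite -(big_mkord xpredT T).
pose N := maxn (size p) n.+1.
rewrite [RHS](big_nat_widen _ _ N) ?leq_maxr //.
rewrite [LHS](big_nat_widen _ _ N) ?leq_maxl //.
rewrite big_mkcond [RHS]big_mkcond; apply: eq_bigr => k _ /=.
by case: ltnP => [_|/T_sz E]; case: ltnP => [_|/T_big E'] //; rewrite ?E ?E'.
Qed.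

Lemma ser_comp0 g f : ser_comp g f 0 = 0.
Proof. by rewrite /ser_comp big_geq. Qed.

Lemma ser_comp1 g f : f 0%N = 0 -> ser_comp g f 1 = g 1%N * f 1%N.
Proof. by move=> f0; rewrite /ser_comp big_nat1 ser_pow_diag. Qed.

Lemma ser_compA h g f : h 0%N = 0 -> g 0%N = 0 -> f 0%N = 0 ->
  ser_comp h (ser_comp g f) = ser_comp (ser_comp h g) f.
Proof.
move=> h0 g0 f0; apply/funext => n.
pose tr u : {poly F} := \poly_(i < n.+1) u i.
have trE u i : (i <= n)%N -> u i = (tr u)`_i.
  by move=> le_i; rewrite coef_poly ltnS le_i.
have tr0 u : u 0%N = 0 -> (tr u)`_0 = 0 by rewrite -trE.
have compE u v i : u 0%N = 0 -> v 0%N = 0 -> (i <= n)%N ->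
    ser_comp u v i = (tr u \Po tr v)`_i.
  move=> u0 v0 le_i; rewrite coef_ser_comp ?tr0 //.
  by apply: eq_ser_comp => j le_j; apply: trE (leq_trans le_j le_i).
have comp0 u v : u 0%N = 0 -> v 0%N = 0 -> (tr u \Po tr v)`_0 = 0.
  by move=> u0 v0; rewrite -compE // ser_comp0.
rewrite (eq_ser_comp (f' := nth 0 (tr g \Po tr f)) (g' := nth 0 (tr h)));
  [|by move=> i; apply: compE|exact: trE].
rewrite [RHS](eq_ser_comp (f' := nth 0 (tr f)) (g' := nth 0 (tr h \Po tr g)));
  [|exact: trE|by move=> i; apply: compE].
by rewrite -!coef_ser_comp ?tr0 ?comp0 // comp_polyA.
Qed.

Lemma ser_pow1 f : ser_pow f 1 = f.
Proof.
apply/funext => n; rewrite ser_powS /ser_mul big_ord_recr /= subnn /ser_one.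
rewrite mulr1 big1 ?add0r // => i _.
by rewrite subn_eq0 leqNgt ltn_ord mulr0.
Qed.

Lemma ser_comp1s f : f 0%N = 0 -> ser_comp ser_id f = f.
Proof.
move=> f0; apply/funext => -[|n]; first by rewrite ser_comp0.
rewrite /ser_comp big_ltn // ser_pow1 mul1r big_nat_cond big1 ?addr0 //.
by move=> [|[|k]] // _; rewrite mul0r.
Qed.

Lemma ser_pow_id k n : ser_pow ser_id k n = (n == k)%:R.
Proof.
transitivity (('X ^+ k : {poly F})`_n); last by rewrite coefXn.
rewrite coef_ser_pow; apply: eq_ser_pow => i _; by rewrite coefX.
Qed.

Lemma ser_comps1 f : f 0%N = 0 -> ser_comp f ser_id = f.
Proof.
move=> f0; apply/funext => -[|n]; first by rewrite ser_comp0.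
rewrite /ser_comp big_nat_recr // ser_pow_id eqxx mulr1.
rewrite big_nat_cond big1 => [|k /andP[/andP[_ lt_k] _]]; first exact: add0r.
by rewrite ser_pow_id gtn_eqF ?mulr0.
Qed.

(* The left inverse g of f: since [z^n] f^n = f_1^n, the equation
   [z^n](g o f) = [n = 1] determines g_n from the g_k with k < n. *)
Fixpoint ser_inv_seq f n : seq F :=
  if n is m.+1 then
    let s := ser_inv_seq f m in
    rcons s ((ser_id m - \sum_(1 <= k < m) s`_k * ser_pow f k m)
             / f 1%N ^+ m)
  else [::].

Definition ser_inv f : nat -> F := fun n => (ser_inv_seq f n.+1)`_n.

Lemma size_ser_inv_seq f n : size (ser_inv_seq f n) = n.
Proof. by elim: n => [//|n IHn] /=; rewrite size_rcons IHn. Qed.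

Lemma nth_ser_inv_seq f n k : (k < n)%N -> (ser_inv_seq f n)`_k = ser_inv f k.
Proof.
elim: n => [//|n IHn]; rewrite ltnS leq_eqVlt => /orP[/eqP-> //|lt_k] /=.
by rewrite nth_rcons size_ser_inv_seq lt_k IHn.
Qed.

Lemma ser_invE f n : ser_inv f n =
  (ser_id n - \sum_(1 <= k < n) ser_inv f k * ser_pow f k n) / f 1%N ^+ n.
Proof.
rewrite {1}/ser_inv /= nth_rcons size_ser_inv_seq ltnn eqxx.
congr ((_ - _) / _); apply: eq_big_nat => k /andP[_ lt_k].
by rewrite nth_ser_inv_seq.
Qed.

Lemma ser_inv0 f : ser_inv f 0 = 0.
Proof. by rewrite ser_invE big_geq // /ser_id subrr mul0r. Qed.

Lemma ser_inv1 f : ser_inv f 1 = (f 1%N)^-1.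
Proof. by rewrite ser_invE big_geq // subr0 mul1r. Qed.

Lemma ser_compVs f : f 0%N = 0 -> f 1%N != 0 ->
  ser_comp (ser_inv f) f = ser_id.
Proof.
move=> f0 f1; apply/funext => -[|n]; first by rewrite ser_comp0.
rewrite /ser_comp big_nat_recr // ser_pow_diag // (ser_invE f n.+1).
by rewrite divfK ?expf_neq0 //; apply: subrKC.
Qed.

Record X0 := MkX0 {
  coefs :> nat -> F;
  _ : (coefs 0%N == 0) && (coefs 1%N != 0)
}.

HB.instance Definition _ := [isSub for coefs].
HB.instance Definition _ := gen_eqMixin X0.
HB.instance Definition _ := gen_choiceMixin X0.

Lemma coefs0 (f : X0) : f 0%N = 0.
Proof. by case: f => f /= /andP[/eqP]. Qed.

Lemma coefs1 (f : X0) : f 1%N != 0.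
Proof. by case: f => f /= /andP[]. Qed.

Lemma X0_id_subproof : (ser_id 0%N == 0) && (ser_id 1%N != 0).
Proof. by rewrite /ser_id eqxx oner_neq0. Qed.

Lemma X0_comp_subproof (g f : X0) :
  (ser_comp g f 0%N == 0) && (ser_comp g f 1%N != 0).
Proof. by rewrite ser_comp0 ser_comp1 ?coefs0 // mulf_neq0 ?coefs1 ?eqxx. Qed.

Lemma X0_inv_subproof (f : X0) : (ser_inv f 0%N == 0) && (ser_inv f 1%N != 0).
Proof. by rewrite ser_inv0 ser_inv1 eqxx invr_neq0 ?coefs1. Qed.

Definition X0_id : X0 := MkX0 X0_id_subproof.
Definition X0_comp (g f : X0) : X0 := MkX0 (X0_comp_subproof g f).
Definition X0_inv (f : X0) : X0 := MkX0 (X0_inv_subproof f).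

Lemma X0_compA : associative X0_comp.
Proof. by move=> h g f; apply/val_inj/ser_compA; apply: coefs0. Qed.

Lemma X0_comp1s : left_id X0_id X0_comp.
Proof. by move=> f; apply/val_inj/ser_comp1s/coefs0. Qed.

Lemma X0_comps1 : right_id X0_id X0_comp.
Proof. by move=> f; apply/val_inj/ser_comps1/coefs0. Qed.

Lemma X0_compVs : left_inverse X0_id X0_inv X0_comp.
Proof. by move=> f; apply/val_inj/ser_compVs; [apply: coefs0|apply: coefs1]. Qed.

Lemma X0_compsV : right_inverse X0_id X0_inv X0_comp.
Proof.
move=> f; rewrite -[LHS]X0_comp1s -{1}(X0_compVs (X0_inv f)) -X0_compA.
by rewrite (X0_compA (X0_inv f)) X0_compVs X0_comp1s X0_compVs.
Qed.

(* In this group (g * f)%g is the composite g o f. *)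
HB.instance Definition _ :=
  isGroup.Build X0 X0_compA X0_comp1s X0_comps1 X0_compVs X0_compsV.

End Series.

Definition normal_closed (T : groupType) (G : set T) : Prop :=
  forall x y : T, G x -> G (x ^ y)%g.

(* Main.v *)
Require Import Defs.
From mathcomp Require Import all_boot all_algebra.
From mathcomp Require Import boolp classical_sets reals complex.

(** A normal subgroup is a union of conjugacy classes, and the conjugacy class
of a series [f] whose linear coefficient [a] is not a root of unity is as large
as it can be: it is the set of all series with linear coefficient [a].  This is
the formal version of Koenigs' linearization theorem
([X0_conj_scale], [X0_conj_of_eq_coef1]): there is a series [phi] tangent to the
identity with [phi o f = a phi], because comparing the coefficients of [z^n]
gives an equation for [phi_n] whose leading factor [a - a^n] does not vanish.

Now let [G] be normal and let [f] in [G] have linear coefficient [a <> 1]; by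
hypothesis [a] is not a root of unity, so [G] contains every series with linear
coefficient [a].  If [h] is tangent to the identity, both [f] and [f o h] have
linear coefficient [a], hence [h] lies in [G].  Thus [G] contains the kernel of
the homomorphism [f |-> f_1] from the group of series to the nonzero scalars, so
it is the full preimage of its image, which is the required subgroup [G']
([normal_closed_eq_coef1]).
Conversely a preimage under this homomorphism is normal, because its target is
commutative. *)

Import GRing.Theory.

Local Open Scope classical_set_scope.
Local Open Scope ring_scope.

Lemma X0_coef1M {F : fieldType} (g f : X0 F) :
  (g * f)%g 1%N = g 1%N * f 1%N.
Proof. exact/ser_comp1/coefs0. Qed.

Lemma X0_coef1V {F : fieldType} (f : X0 F) : (f^-1)%g 1%N = (f 1%N)^-1.
Proof. exact: ser_inv1. Qed.

Lemma X0_coef1J {F : fieldType} (f g : X0 F) : (f ^ g)%g 1%N = f 1%N.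
Proof. by rewrite conjgE !X0_coef1M X0_coef1V mulrCA mulVf ?coefs1 ?mulr1. Qed.

(** The [n]-th value may depend on all the earlier ones; [step] is given a total
function, so that its dependence on the values below [n] has to be a
hypothesis. *)
Lemma course_of_values_rec {T : Type} (x0 : T) (step : nat -> (nat -> T) -> T) :
  (forall n u v, (forall k, (k < n)%N -> u k = v k) -> step n u = step n v) ->
  exists u : nat -> T, forall n, u n = step n u.
Proof.
move=> step_ext.
(* [s n] lists the first [n] values. *)
pose s := fix s n := if n is m.+1 then rcons (s m) (step m (nth x0 (s m)))
                     else [::].
have size_s n : size (s n) = n by elim: n => //= n IHn; rewrite size_rcons IHn.
have nth_s n k : (k < n)%N -> nth x0 (s n) k = nth x0 (s k.+1) k.
  elim: n => // n IHn; rewrite ltnS leq_eqVlt => /predU1P[-> //|lt_kn].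
  by rewrite [LHS]/= nth_rcons size_s lt_kn IHn.
exists (fun n => nth x0 (s n.+1) n) => n /=.
rewrite nth_rcons size_s ltnn eqxx.
by apply: step_ext => k /nth_s.
Qed.

Lemma X0_scale_subproof {F : fieldType} (a : F) : a != 0 ->
  (a * ser_id F 0%N == 0) && (a * ser_id F 1%N != 0).
Proof. by move=> a_neq0; rewrite /ser_id mulr0 mulr1 eqxx. Qed.

Definition X0_scale {F : fieldType} {a : F} (a_neq0 : a != 0) : X0 F :=
  @MkX0 F (fun n => a * ser_id F n) (X0_scale_subproof a a_neq0).

Lemma X0_scaleM {F : fieldType} {a : F} (a_neq0 : a != 0) (f : X0 F) n :
  (X0_scale a_neq0 * f)%g n = a * f n.
Proof.
rewrite -{2}(X0_comp1s f) /= /ser_comp big_distrr /=.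
by apply: eq_bigr => k _; rewrite mulrA.
Qed.

(** Formal Koenigs linearization.  In [phi o f = a phi] the coefficient of [z^n]
reads [phi_n (a - a^n) = sum_(1 <= k < n) phi_k [z^n]f^k]; for [n > 1] the factor
is nonzero and determines [phi_n], while for [n = 1] the equation is void and
[phi_1] may be chosen to be [1]. *)
Lemma X0_conj_scale {F : fieldType} (f : X0 F) :
    (forall n, (0 < n)%N -> f 1%N ^+ n != 1) ->
  exists phi : X0 F, f = (X0_scale (coefs1 f) ^ phi)%g.
Proof.
set a := f 1%N => a_nroot.
pose step n (u : nat -> F) : F :=
  if (n <= 1)%N then (n == 1)%:R
  else (\sum_(1 <= k < n) u k * ser_pow f k n) / (a - a ^+ n).
have [n u v eq_uv|u uE] := course_of_values_rec 0 step.
  rewrite /step; case: ifP => // _; congr (_ / _).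
  by apply: eq_big_nat => k /andP[_ lt_kn]; rewrite eq_uv.
have u_ok : (u 0%N == 0) && (u 1%N != 0).
  by rewrite !uE /step /= eqxx oner_neq0.
exists (MkX0 u_ok); rewrite conjgE.
apply: (mulgI (MkX0 u_ok)); rewrite mulVKg; apply/val_inj/funext => n.
rewrite [RHS]X0_scaleM /= -/a; case: n => [|n].
  by rewrite ser_comp0 uE mulr0.
have -> : ser_comp u f n.+1 =
    \sum_(1 <= k < n.+1) u k * ser_pow f k n.+1 + u n.+1 * a ^+ n.+1.
  by rewrite /ser_comp big_nat_recr // ser_pow_diag ?coefs0.
case: n => [|n]; first by rewrite big_geq // add0r mulrC.
have neq0 : a - a ^+ n.+2 != 0.
  rewrite exprS -[X in X - _]mulr1 -mulrBr mulf_neq0 ?coefs1 //.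
  by rewrite subr_eq0 eq_sym a_nroot.
suff -> : \sum_(1 <= k < n.+2) u k * ser_pow f k n.+2
          = u n.+2 * (a - a ^+ n.+2).
  by rewrite -mulrDr subrK mulrC.
by rewrite [u n.+2]uE /step /= divfK.
Qed.

Lemma X0_conj_of_eq_coef1 {F : fieldType} (f g : X0 F) :
    (forall n, (0 < n)%N -> f 1%N ^+ n != 1) -> f 1%N = g 1%N ->
  exists phi : X0 F, g = (f ^ phi)%g.
Proof.
move=> f_nroot eq_fg.
have [phi f_lin] := X0_conj_scale f f_nroot.
have [|psi g_lin] := X0_conj_scale g; first by rewrite -eq_fg.
exists (phi^-1 * psi)%g; rewrite conjgM {1}f_lin conjgK g_lin.
by congr (_ ^ _)%g; apply/val_inj/funext => n; rewrite /= eq_fg.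
Qed.

(** If [h] and [g] in [G] have the same linear coefficient, then [f] and
[f g^-1 h] also do, so they are conjugate, and [h] is obtained from elements
of [G]. *)
Lemma normal_closed_eq_coef1 {F : fieldType} (G : set (X0 F)) (f g h : X0 F) :
    group_closed (mem G) -> normal_closed G ->
    G f -> (forall n, (0 < n)%N -> f 1%N ^+ n != 1) ->
  G g -> g 1%N = h 1%N -> G h.
Proof.
move=> groupG normG Gf f_nroot Gg eq_gh.
have memG x : G x -> x \in G by move=> Gx; rewrite in_setE.
have [|phi conj_f] := X0_conj_of_eq_coef1 f (f * (g^-1 * h))%g f_nroot.
  by rewrite !X0_coef1M X0_coef1V eq_gh mulVf ?coefs1 // mulr1.
have /memG Gfgh : G (f * (g^-1 * h))%g by rewrite conj_f; apply: normG.
have -> : h = (g * (f^-1 * (f * (g^-1 * h))))%g by rewrite mulKg mulVKg.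
rewrite -in_setE; apply: (group_closedM groupG); first exact: memG.
apply: (group_closedM groupG) => //.
exact/(group_closedV groupG)/memG.
Qed.

Theorem proposition4p5 (R : realType) (G : set (X0 R[i]))
    (groupG : group_closed (mem G))
    (no_root_of_unity : ~ exists f : X0 R[i], [/\ G f,
        exists2 n : nat, (0 < n)%N & n.-unity_root (f 1%N) & f 1%N <> 1])
    (coef1_neq1 : exists2 f : X0 R[i], G f & f 1%N <> 1) :
  normal_closed G <->
  exists G' : set R[i],
    [/\ ~ G' 0, GRing.divr_closed (mem G') & G = [set f : X0 R[i] | G' (f 1%N)]].
Proof.
split=> [normG|[G' [_ _ ->]] f g]; last by rewrite /mkset X0_coef1J.
have [f Gf f1_neq1] := coef1_neq1.
have f_nroot n : (0 < n)%N -> f 1%N ^+ n != 1.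
  move=> n_gt0; apply/negP => f_root; apply: no_root_of_unity.
  by exists f; split=> //; exists n; rewrite ?unity_rootE.
exists [set g 1%N | g in G]; split.
- by case=> g _ g1_eq0; have := coefs1 g; rewrite g1_eq0 eqxx.
- split=> [|_ _ /set_mem[g Gg <-] /set_mem[h Gh <-]].
    rewrite in_setE; exists 1%g => //.
    by have [] := groupG; rewrite in_setE.
  rewrite in_setE; exists (g * h^-1)%g; last by rewrite X0_coef1M X0_coef1V.
  by rewrite -in_setE; apply: (proj2 groupG); rewrite in_setE.
- apply/seteqP; split=> h /=; first by exists h.
  by case=> g Gg; apply: (normal_closed_eq_coef1 G f g).
Qed.
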